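(* Let $2\le n<\infty$. (i) For $m=(n-1)k+1$ ($k\ge2$) and $z\in\mathcal{W}_m$, $$\alpha_g^*(\omega'_z)=\omega'_{\tilde gz}\qquad(g\in U(n-1)),$$ where $\tilde g=(\tilde g_{i,j})\in U(m-1)\subset U(m)$ is defined as $\tilde g_{(n-1)a+i,(n-1)b+j}:=\delta_{ab}\,g_{ij}$ for $i,j=1,\ldots,n-1$ and $0\le a,b\le k-1$, and $\tilde g_{m,m}:=1$ (all other entries being $0$). (ii) For any $z\in\ell^2_1$, $$\alpha_g^*(\omega'_z)=\omega'_{\tilde gz}\qquad(g\in U(n-1)),$$ where $\tilde g$ is the unitary operator on $\ell^2$ whose matrix components with respect to the standard basis are $\tilde g_{(n-1)a+i,(n-1)b+j}:=\delta_{ab}\,g_{ij}$ for $i,j=1,\ldots,n-1$ and $a,b\ge0$.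
   Context: For $2\le n<\infty$, $\mathcal{O}_n$ denotes the Cuntz algebra: the universal unital C$^*$-algebra generated by $s_1,\ldots,s_n$ with $s_i^*s_j=\delta_{ij}I$ and $\sum_{i=1}^n s_is_i^*=I$. $\ell^2_1$ is the set of unit vectors of $\ell^2=\ell^2(\{1,2,\ldots\})$, and $\mathcal{W}_m:=\{(w_1,\ldots,w_m)\in\mathbb{C}^m:\|w\|=1,\ |w_m|<1\}$. Convention: $s_n^0=I$. For $m=(n-1)k+1$ with $k\ge2$ and $z\in\mathcal{W}_m$, $\omega'_z$ denotes the geometric progression state of order $k$ by $z$: the unique (and pure) state on $\mathcal{O}_n$ with $\omega'_z(s_n^rs_i)=\overline{z_{(n-1)r+i}}$ for all $r=0,\ldots,k-1$, $i=1,\ldots,n-1$, and $\omega'_z(s_n^k)=\overline{z_m}$. For $z\in\ell^2_1$, $\omega'_z$ denotes the geometric progression state of order $\infty$ by $z$: the unique (and pure) state on $\mathcal{O}_n$ with $\omega'_z(s_n^rs_i)=\overline{z_{(n-1)r+i}}$ for all $r\ge 0$, $i=1,\ldots,n-1$. $U(n)$ acts on $\mathcal{O}_n$ by automorphisms $\alpha_g(s_i):=\sum_{j=1}^n g_{ji}s_j$ for $g=(g_{ij})\in U(n)$, and for a state $\omega$ on $\mathcal{O}_n$, $\alpha_g^*(\omega):=\omega\circ\alpha_{g^{-1}}$. For each $m$, $U(m-1)$ is regarded as a subgroup of $U(m)$ via $g\mapsto\begin{pmatrix}g&0\\0&1\end{pmatrix}$ (so for $g\in U(n-1)$, $\alpha_g(s_n)=s_n$).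 $U(m)$ acts on $\mathbb{C}^m$ in the standard way, $(gz)_i=\sum_j g_{ij}z_j$; similarly for operators on $\ell^2$. *)

(* Defs.v *)
From HB Require Import structures.
From mathcomp Require Import all_boot all_order all_algebra.
From mathcomp Require Import complex.
From mathcomp Require Import all_classical all_reals all_analysis.

Set Implicit Arguments.
Unset Strict Implicit.
Unset Printing Implicit Defensive.

Import Order.TTheory GRing.Theory Num.Theory.
Import numFieldNormedType.Exports.

Local Open Scope classical_set_scope.
Local Open Scope ring_scope.

(* Unital nonzero C*-algebras.  The norm and its completeness are part of the
   mixin because a structure inheriting both from the rings and from the normed
   modules of the library clashes with the inheritance of numDomainType. *)
HB.mixin Record Algebra_isCStarAlgebra (R : realType) A
    & GRing.Algebra (complex R) A := {
  adj : A -> A;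
  cnorm : A -> R;
  adjK : involutive adj;
  adjD : forall x y : A, adj (x + y) = adj x + adj y;
  adjZ : forall (c : complex R) (x : A), adj (c *: x) = c^* *: adj x;
  adjM : forall x y : A, adj (x * y) = adj y * adj x;
  cnorm_eq0 : forall x : A, cnorm x = 0 -> x = 0;
  ler_cnormD : forall x y : A, cnorm (x + y) <= cnorm x + cnorm y;
  cnormZ : forall (c : complex R) (x : A),
    cnorm (c *: x) = ComplexField.Normc.normc c * cnorm x;
  ler_cnormM : forall x y : A, cnorm (x * y) <= cnorm x * cnorm y;
  cnorm_cstar : forall x : A, cnorm (adj x * x) = cnorm x ^+ 2;
  cnorm_complete : forall u : nat -> A,
    (forall e : R, 0 < e -> exists N : nat, forall p q : nat,
       (N <= p)%N -> (N <= q)%N -> cnorm (u p - u q) < e) ->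
    exists l : A, (fun p => cnorm (u p - l)) @ \oo --> (0 : R)
}.

#[short(type="cstarAlgType")]
HB.structure Definition CStarAlgebra (R : realType) :=
  {A of Algebra_isCStarAlgebra R A & GRing.Algebra (complex R) A}.

Section Cuntz.
Variable R : realType.
Local Notation C := (complex R).
Local Notation normc := ComplexField.Normc.normc.

Definition star_hom (A B : cstarAlgType R) (f : A -> B) : Prop :=
  [/\ linear f, {morph f : x y / x * y}, f 1 = 1 & {morph f : x / adj x}].

(* A state is a positive linear functional of norm one; on a unital C*-algebra
   the norm of a positive functional is its value at 1. *)
Definition is_state (A : cstarAlgType R) (w : A -> C) : Prop :=
  [/\ scalar w, forall x, 0 <= w (adj x * x),
      forall x, normc (w x) <= cnorm x & w 1 = 1].

Definition cuntz_relations n (A : cstarAlgType R) (s : 'I_n -> A) : Prop :=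
  (forall i j, adj (s i) * s j = (i == j)%:R) /\ \sum_i s i * adj (s i) = 1.

Definition norm_closed (A : cstarAlgType R) (S : set A) : Prop :=
  forall x, (forall e : R, 0 < e -> exists2 y, S y & cnorm (x - y) < e) -> S x.

Definition generates n (A : cstarAlgType R) (s : 'I_n -> A) : Prop :=
  forall S : set A, norm_closed S -> S 1 -> (forall i, S (s i)) ->
    (forall (c : C) x y, S x -> S y -> S (c *: x + y)) ->
    (forall x y, S x -> S y -> S (x * y)) ->
    (forall x, S x -> S (adj x)) -> S = setT.

Definition is_cuntz_algebra n (A : cstarAlgType R) (s : 'I_n -> A) : Prop :=
  [/\ cuntz_relations s, generates s
    & forall (B : cstarAlgType R) (t : 'I_n -> B), cuntz_relations t ->
        exists! f : A -> B, star_hom f /\ forall i, f (s i) = t i].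

(* When s generates the Cuntz algebra and g is unitary there is exactly one such
   f, see cuntz_actP; otherwise the value is irrelevant. *)
Definition cuntz_act n (A : cstarAlgType R) (s : 'I_n -> A) (g : 'M[C]_n) :
    A -> A :=
  xget (idfun : A -> A) [set f : A -> A |
    star_hom f /\ forall i, f (s i) = \sum_j g j i *: s j].

Definition cuntz_act_dual n (A : cstarAlgType R) (s : 'I_n -> A) (g : 'M[C]_n)
    (w : A -> C) : A -> C :=
  w \o cuntz_act s (invmx g).

(* The embedding U(m - 1) -> U(m). *)
Definition embed_last m (g : 'M[C]_m) : 'M[C]_m.+1 :=
  \matrix_(i, j) match unlift ord_max i, unlift ord_max j with
                 | Some i', Some j' => g i' j'
                 | None, None => 1
                 | _, _ => 0
                 end.

(* Below, d stands for n - 1.  Indices are counted from 0: the generators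
   s_1, ..., s_(n-1) are s (widen_ord (leqnSn d) i) for i : 'I_d, the generator
   s_n is s ord_max, and the coordinate z_((n-1)r+i) with 1 <= i <= n - 1 is the
   one of index d * r + i with i : 'I_d. *)

(* C^m for m = (n-1)k+1 *)
Definition in_W d k (z : 'cV[C]_(d * k).+1) : Prop :=
  \sum_j normc (z j 0) ^+ 2 = 1 /\ normc (z ord_max 0) < 1.

Definition ell2_unit (z : nat -> C) : Prop :=
  series (fun j => normc (z j) ^+ 2) @ \oo --> (1 : R).

Definition is_gp_state d k (A : cstarAlgType R) (s : 'I_d.+1 -> A)
    (z : 'cV[C]_(d * k).+1) (w : A -> C) : Prop :=
  [/\ is_state w,
      forall (r : 'I_k) (i : 'I_d),
        w (s ord_max ^+ r * s (widen_ord (leqnSn d) i))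
        = (z (inord (d * r + i)) 0)^*
    & w (s ord_max ^+ k) = (z ord_max 0)^*].

Definition is_gp_state_infty d (A : cstarAlgType R) (s : 'I_d.+1 -> A)
    (z : nat -> C) (w : A -> C) : Prop :=
  is_state w /\
  forall (r : nat) (i : 'I_d),
    w (s ord_max ^+ r * s (widen_ord (leqnSn d) i)) = (z (d * r + i)%N)^*.

(* The state omega'_z, of finite and of infinite order.  The second argument of
   xget would only matter if no such state existed. *)
Definition gp_state d k (A : cstarAlgType R) (s : 'I_d.+1 -> A)
    (z : 'cV[C]_(d * k).+1) : A -> C :=
  xget ((fun=> 0) : A -> C) [set w | is_gp_state s z w].

Definition gp_state_infty d (A : cstarAlgType R) (s : 'I_d.+1 -> A)
    (z : nat -> C) : A -> C :=
  xget ((fun=> 0) : A -> C) [set w | is_gp_state_infty s z w].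

(* The coefficient of index (x, y) of the infinite block-diagonal matrix
   diag(g, g, ...), see tilde_coefE. *)
Definition tilde_coef d (g : 'M[C]_d) (x y : nat) : C :=
  \sum_(i < d) \sum_(j < d)
    if [&& x %/ d == y %/ d, x %% d == i & y %% d == j]%N then g i j else 0.

Definition tilde_mx d k (g : 'M[C]_d) : 'M[C]_((d * k).+1) :=
  embed_last (\matrix_(x, y) tilde_coef g x y).

(* The action on ell^2 of the operator with matrix T in the standard basis. *)
Definition ell2_mul (T : nat -> nat -> C) (z : nat -> C) : nat -> C :=
  fun x => limn (series (fun y => (T x y * z y : C^o))).

Lemma tilde_coefE d (g : 'M[C]_d) (a b : nat) (i j : 'I_d) :
  tilde_coef g (d * a + i) (d * b + j) = (a == b)%:R * g i j.
Proof.
have d_gt0 : (0 < d)%N by apply: leq_ltn_trans (ltn_ord i).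
rewrite /tilde_coef ![(d * _)%N]mulnC !divnMDl // !modnMDl.
rewrite !divn_small // !addn0 !modn_small //.
rewrite (bigD1 i) //= (bigD1 j) //= !eqxx !andbT.
rewrite [X in _ + X + _]big1 => [|j' nj]; last first.
  by move: nj; rewrite -val_eqE /= eq_sym => /negPf ->; rewrite andbF.
rewrite big1 => [|i' ni]; last first.
  move: ni; rewrite -val_eqE /= eq_sym => /negPf ni; rewrite big1 // => j' _.
  by rewrite ni andbF.
rewrite !addr0.
by case: eqP; rewrite ?mul1r ?mul0r.
Qed.

Lemma adj0 (A : cstarAlgType R) : adj (0 : A) = 0.
Proof. by have := adjZ 0 (0 : A); rewrite !scale0r conjC0 scale0r. Qed.

Lemma adj_sum (A : cstarAlgType R) (I : Type) (r : seq I) (F : I -> A) :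
  adj (\sum_(i <- r) F i) = \sum_(i <- r) adj (F i).
Proof. by apply: (big_morph _ (@adjD _ A)); exact: adj0. Qed.

Lemma cuntz_relations_act n (A : cstarAlgType R) (s : 'I_n -> A) (g : 'M[C]_n) :
  cuntz_relations s -> g \is unitarymx ->
  cuntz_relations (fun i => \sum_j g j i *: s j).
Proof.
move=> [sO s1] gU; split.
- move=> i j; rewrite adj_sum mulr_suml.
  have /(congr1 (fun M : 'M[C]_n => M i j)) : g^t*%sesqui *m g = 1%:M.
    by apply: mulmx1C; apply/unitarymxP.
  rewrite !mxE => gij; transitivity ((i == j)%:R%:A : A); last first.
    by case: (i == j); rewrite ?scale1r ?scale0r.
  rewrite -gij scaler_suml; apply: eq_bigr => l _.
  rewrite adjZ mulr_sumr (bigD1 l) //= [X in _ + X]big1 ?addr0 => [|l' /negPf nl].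
    by rewrite -scalerAl -scalerAr sO eqxx scalerA !mxE.
  by rewrite -scalerAl -scalerAr sO eq_sym nl !scaler0.
- rewrite -s1.
  transitivity (\sum_i \sum_j \sum_l (g j i * (g l i)^*) *: (s j * adj (s l))).
    apply: eq_bigr => i _; rewrite adj_sum mulr_suml; apply: eq_bigr => j _.
    rewrite mulr_sumr; apply: eq_bigr => l _.
    by rewrite adjZ -scalerAl -scalerAr scalerA.
  rewrite exchange_big; apply: eq_bigr => j _ /=.
  rewrite exchange_big (bigD1 j) //= [X in _ + X]big1 ?addr0 => [|l /negPf nl].
    rewrite -scaler_suml; have /unitarymxP := gU.
    move=> /(congr1 (fun M : 'M[C]_n => M j j)); rewrite !mxE eqxx => gjj.
    rewrite (_ : \sum_i _ = 1) ?scale1r // -[RHS]gjj; apply: eq_bigr => i _.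
    by rewrite !mxE.
  rewrite -scaler_suml; have /unitarymxP := gU.
  move=> /(congr1 (fun M : 'M[C]_n => M j l)); rewrite !mxE eq_sym nl => gjl.
  rewrite (_ : \sum_i _ = 0) ?scale0r // -[RHS]gjl; apply: eq_bigr => i _.
  by rewrite !mxE.
Qed.

Lemma cuntz_actP n (A : cstarAlgType R) (s : 'I_n -> A) (g : 'M[C]_n) :
  is_cuntz_algebra s -> g \is unitarymx ->
  star_hom (cuntz_act s g) /\ forall i, cuntz_act s g (s i) = \sum_j g j i *: s j.
Proof.
move=> [srel _ univ] gU; rewrite /cuntz_act.
have [f [fP _]] := univ A _ (cuntz_relations_act srel gU).
by case: xgetP => [h _ //|/(_ f)].
Qed.

End Cuntz.

(* Main.v *)
(** Pulling back along [alpha_g] exchanges the states with the values prescribed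
    by [z] and those prescribed by [tilde g z]; since the geometric progression
    states are picked by choice, everything rests on their uniqueness, and their
    existence plays no role.
    Let [t] range over the isometries [s_n^r s_i] (and [s_n^k] in the finite
    case); they have orthogonal ranges.  Since [w t = conj z_t] and
    [sum |z_t|^2 = 1], the element [T = sum z_t t] satisfies
    [w (adj (T - 1) (T - 1)) = 0], approximately so for the partial sums in the
    infinite case, so by Cauchy-Schwarz [w (x T) = w x] and hence
    [w (x (adj t)) = z_t (w x)].  This determines [w] on the words
    [s_J (adj s_K)], whose linear span is dense.  In the finite case it yields
    [w (s_n^r) = known + |z_m|^2 w (s_n^r)], which is where [|z_m| < 1] is needed.
    That [w o alpha_g] is again a state uses that a unital positive functional is
    automatically contractive, by way of a square root of [1 - h]. *)
From HB Require Import structures.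
Require Import Defs.
From mathcomp Require Import all_boot all_order all_algebra complex.
From mathcomp Require Import all_classical all_reals all_analysis.
From mathcomp Require Import ring lra.

Set Implicit Arguments.
Unset Strict Implicit.
Unset Printing Implicit Defensive.

Import Order.TTheory GRing.Theory Num.Theory.
Import numFieldNormedType.Exports.
Import Defs.

Local Open Scope ring_scope.

Lemma lift_max_widen n (j : 'I_n) : lift ord_max j = widen_ord (leqnSn n) j.
Proof. by apply: val_inj; exact: lift_max. Qed.

(** * Norm identities and square roots in a C*-algebra *)

Section CStarNorm.
Variables (R : realType) (A : cstarAlgType R).
Local Notation C := (complex R).
Local Notation normc := ComplexField.Normc.normc.
Implicit Types (x y : A) (c : C).

Lemma normr_normc (c : C) : `|c| = (normc c)%:C%C. Proof. by []. Qed.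

Lemma adjN x : adj (- x) = - adj x.
Proof. by rewrite -scaleN1r adjZ rmorphN1 scaleN1r. Qed.

Lemma adjB x y : adj (x - y) = adj x - adj y.
Proof. by rewrite adjD adjN. Qed.

Lemma adj1 : adj (1 : A) = 1.
Proof. by rewrite -[LHS]mulr1 -{2}[1]adjK -adjM mulr1 adjK. Qed.

Lemma cnorm0 : cnorm (0 : A) = 0.
Proof. by rewrite -(scale0r (0 : A)) cnormZ ComplexField.Normc.normc0 mul0r. Qed.

Lemma normcN1 : normc (-1 : C) = 1.
Proof. by apply: complexI; rewrite -normr_normc normrN1. Qed.

Lemma cnormN x : cnorm (- x) = cnorm x.
Proof. by rewrite -scaleN1r cnormZ normcN1 mul1r. Qed.

Lemma cnorm_ge0 x : 0 <= cnorm x.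
Proof.
have := ler_cnormD x (- x); rewrite subrr cnorm0 cnormN => ?; lra.
Qed.

Lemma cnormB x y : cnorm (x - y) = cnorm (y - x).
Proof. by rewrite -cnormN opprB. Qed.

(** The C*-identity and submultiplicativity give [cnorm y ^+ 2 <= cnorm (adj y) * cnorm y]; cancel
    [cnorm y], and use the result for [x] and for [adj x]. *)
Lemma cnorm_adj x : cnorm (adj x) = cnorm x.
Proof.
have le y : cnorm y <= cnorm (adj y).
  have := cnorm_cstar y; have := ler_cnormM (adj y) y.
  have := cnorm_ge0 y; rewrite le_eqVlt => /predU1P[<-|y0]; first by rewrite cnorm_ge0.
  move=> leM E; rewrite -(ler_pM2r y0) -expr2; lra.
by apply/eqP; rewrite eq_le le andbT -{2}[x]adjK le.
Qed.

(* The fixed point [u] of the contraction [v |-> (h + v^2) / 2] satisfies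
   [(1 - u)^2 = 1 - h]. *)
Lemma sqrt_one_sub (h : A) : adj h = h -> cnorm h < 1 ->
  exists y : A, adj y = y /\ y * y = 1 - h.
Proof.
move=> hh h1; set r := cnorm h in h1.
have r0 : 0 <= r by exact: cnorm_ge0.
pose f (v : A) : A := (2^-1 : R)%:C%C *: (h + v * v).
have cZ (a : R) (x : A) : 0 <= a -> cnorm (a%:C%C *: x) = a * cnorm x.
  move=> a0; rewrite cnormZ; congr (_ * _).
  by rewrite /= expr0n addr0 sqrtr_sqr ger0_norm.
(* The ball of radius [r] is stable because [(r + r ^+ 2) / 2 <= r] for [0 <= r < 1]; on it [f] is
   Lipschitz with constant [r]. *)
have fr v : cnorm v <= r -> cnorm (f v) <= r.
  move=> vr; rewrite /f cZ //.
  have := ler_cnormD h (v * v); have := ler_cnormM v v; have := cnorm_ge0 v.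
  rewrite -/r => *; nra.
have fL v w : cnorm v <= r -> cnorm w <= r -> cnorm (f v - f w) <= r * cnorm (v - w).
  move=> vr wr; rewrite /f -scalerBr cZ //.
  (* A factorization of the difference of squares that does not require [v] and [w] to commute. *)
  have -> : h + v * v - (h + w * w) = v * (v - w) + (v - w) * w.
    by rewrite mulrBr mulrBl opprD addrACA subrr add0r addrA subrK.
  have := ler_cnormD (v * (v - w)) ((v - w) * w).
  have := ler_cnormM v (v - w); have := ler_cnormM (v - w) w.
  have := cnorm_ge0 v; have := cnorm_ge0 w; have := cnorm_ge0 (v - w) => *; nra.
pose u n := iter n f 0.
have ur n : cnorm (u n) <= r.
  by elim: n => [|n IHn]; rewrite ?cnorm0 //=; exact: fr.
have ua n : adj (u n) = u n.
  elim: n => [|n IHn]; first by rewrite adj0.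
  by rewrite /= /f adjZ adjD adjM hh -/(u n) IHn geC0_conj // ler0c invr_ge0 ler0n.
(* Comparing [u n] with all later iterates at once gives the Cauchy property without summing a
   geometric series; for [n = 0] it suffices that [u 0 = 0] and every iterate has norm at most
   [r < 1]. *)
have uD n p : cnorm (u n - u (n + p)%N) <= r ^+ n.
  elim: n => [|n IHn].
    by rewrite sub0r cnormN expr0 (le_trans (ur _)) // ltW.
  rewrite addSn /= (le_trans (fL _ _ (ur _) (ur _))) // exprS.
  by rewrite ler_wpM2l.
have rcvg : (GRing.exp r @ \oo --> (0 : R))%classic.
  by apply: cvg_expr; rewrite ger0_norm.
have [e e0|l ul] := @cnorm_complete R A u.
  have e20 : 0 < e / 2 by rewrite divr_gt0.
  have [N _ NP] := (@cvgrPdist_lt _ _ _ _ _ _ _).1 rcvg _ e20.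
  have NN := NP N (leqnn N).
  rewrite /= sub0r normrN ger0_norm ?exprn_ge0 // in NN.
  exists N => p q Np Nq; have := uD N (p - N)%N; have := uD N (q - N)%N.
  rewrite !subnKC // => Hq Hp.
  have := ler_cnormD (u p - u N) (u N - u q).
  rewrite addrA subrK (cnormB (u p)) => ?; lra.
have eq_lim x y (K : R) (e : nat -> R) : (e @ \oo --> (0 : R))%classic ->
    (forall n, cnorm (x - y) <= K * e n) -> x = y.
  move=> e0 H; apply/eqP; rewrite -subr_eq0; apply/eqP/cnorm_eq0.
  apply/eqP; rewrite eq_le cnorm_ge0 andbT.
  have K0 : (K * e n @[n --> \oo] --> K * 0)%classic by apply: cvgMr.
  rewrite mulr0 in K0; rewrite -(cvg_lim _ K0) //.
  apply: limr_ge; first by apply/cvg_ex; exists 0.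
  by apply: nearW => n; exact: H.
have la : adj l = l.
  apply: (eq_lim _ _ 2 _ ul) => n.
  have := ler_cnormD (adj (l - u n)) (u n - l).
  by rewrite cnorm_adj adjB ua addrA subrK (cnormB l) => ?; lra.
have lr : cnorm l <= r.
  have cr : (r + cnorm (u n - l) @[n --> \oo] --> r + 0)%classic.
    by apply: cvgD ul; exact: cvg_cst.
  rewrite addr0 in cr; rewrite -(cvg_lim _ cr) //.
  apply: limr_ge; first by apply/cvg_ex; exists r.
  apply: nearW => n; have := ler_cnormD (u n) (l - u n).
  by rewrite addrC subrK (cnormB l); have := ur n => *; lra.
have fl : f l = l.
  have ul2 : (cnorm (u n - l) + cnorm (u n.+1 - l) @[n --> \oo] --> 0 + (0 : R))%classic.
    by apply: cvgD => //; rewrite (cvg_shiftS (fun n => cnorm (u n - l))).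
  rewrite addr0 in ul2; apply: (eq_lim _ _ 1 _ ul2) => n.
  have := ler_cnormD (f l - u n.+1) (u n.+1 - l); rewrite addrA subrK.
  have := fL _ _ lr (ur n); rewrite -/(u n.+1) (cnormB l).
  have := cnorm_ge0 (u n - l) => *; nra.
exists (1 - l); rewrite adjB adj1 la; split=> //.
rewrite mulrBl mul1r mulrBr mulr1.
have : (2 : C) *: f l = h + l * l.
  rewrite /f scalerA (_ : _ * _ = 1) ?scale1r //.
  by rewrite -(rmorph_nat (real_complex R)) -rmorphM mulfV ?rmorph1 // pnatr_eq0.
rewrite fl scaler_nat mulr2n => ll.
have -> : h = l + l - l * l by rewrite ll addrK.
by rewrite !opprB -addrA; congr (1 + _); rewrite addrCA opprD.
Qed.
End CStarNorm.

(** * Positive functionals: Cauchy-Schwarz and automatic contractivity *)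

Section PositiveFunctional.
Variables (R : realType) (A : cstarAlgType R).
Local Notation C := (complex R).
Local Notation normc := ComplexField.Normc.normc.

Lemma scalar_bundle (w : A -> C) : scalar w -> exists w' : {scalar A}, w = w'.
Proof.
move=> wL; by exists (HB.pack_for {scalar A} w (GRing.isLinear.Build _ _ _ _ w wL)).
Qed.

Variable w : {scalar A}.
Hypothesis w_ge0 : forall x : A, 0 <= w (adj x * x).

Lemma scalarZ (c : C) (x : A) : w (c *: x) = c * w x.
Proof. exact: (linearZ_LR w). Qed.

(** Polarization: [w] is real on [adj y * y] for [y = c *: x + 1], and comparing [c = 1] with
    [c = 'i] isolates the cross terms. *)
Lemma positive_adj (x : A) : w (adj x) = (w x)^*.
Proof.
have wxx y : (w (adj y * y))^* = w (adj y * y) by exact: geC0_conj.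
have H (c : C) : c^* * (w x)^* + c * (w (adj x))^* = c * w x + c^* * w (adj x).
  have := wxx (c *: x + 1); rewrite adjD adj1 adjZ !mulrDr !mulrDl mulr1 !mul1r.
  rewrite -scalerAl -scalerAr !linearD /= !scalarZ !rmorphD /= !rmorphM /= conjCK.
  have := wxx 1; rewrite adj1 mul1r => ->; rewrite wxx.
  move/eqP; rewrite -subr_eq0 => /eqP E; apply: subr0_eq; rewrite -E.
  by ring.
set a := w x in H *; set b := w (adj x) in H *.
have E1 : (a^* + b^*) - (a + b) = 0.
  by have := H 1; rewrite rmorph1 !mul1r => ->; rewrite subrr.
have E2 : (b^* - a^*) - (a - b) = 0.
  apply: (mulfI (neq0Ci C)); rewrite mulr0.
  have /eqP := H 'i; rewrite !conjCi -subr_eq0 => /eqP <-; ring.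
have two0 : (2 : C) != 0 by rewrite pnatr_eq0.
apply: (mulfI two0); apply: subr0_eq.
rewrite -[RHS](subrr (0 : C)) -{1}E2 -E1; ring.
Qed.

(** Positivity at [y - (t * b) *: adj x] with [b = w (x * y)]. The choice [t = (w (x * adj x))^-1]
    would give the usual inequality; a free [t] avoids a case split on [w (x * adj x) = 0]. *)
Lemma positive_CauchySchwarz (t : C) (x y : A) : 0 <= t ->
  `|w (x * y)| ^+ 2 * (2 * t - t ^+ 2 * w (x * adj x)) <= w (adj y * y).
Proof.
move=> t0; set b := w (x * y).
have wyx : w (adj y * adj x) = b^* by rewrite -adjM positive_adj.
have H := w_ge0 (y - (t * b) *: adj x).
rewrite adjB adjZ adjK mulrBl !mulrBr !linearB /= -!scalerAl -!scalerAr !scalarZ in H.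
rewrite wyx -/b rmorphM /= (geC0_conj t0) in H.
rewrite -subr_ge0 normCK; move: H; congr (0 <= _); ring.
Qed.

Hypothesis w1 : w 1 = 1.

Lemma positive_le_selfadjoint (h : A) : adj h = h -> cnorm h < 1 -> w h <= 1.
Proof.
move=> hh h1; have [y [yy yh]] := sqrt_one_sub hh h1.
by have := w_ge0 y; rewrite yy yh linearB /= w1 subr_ge0.
Qed.

(** Cauchy-Schwarz against 1 bounds [|w x| ^+ 2] by [w (adj x * x)], and the C*-identity turns the
    bound for self-adjoint elements into [cnorm x ^+ 2]. *)
Lemma positive_contractive (x : A) : normc (w x) <= cnorm x.
Proof.
have cs : `|w x| ^+ 2 <= w (adj x * x).
  have := @positive_CauchySchwarz 1 1 x ler01.
  rewrite !mul1r adj1 w1 (_ : 2 * 1 - 1 ^+ 2 * 1 = 1) ?mulr1 //; ring.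
have wx : w (adj x * x) <= (cnorm x ^+ 2)%:C%C.
  rewrite -cnorm_cstar; set h := adj x * x.
  have hh : adj h = h by rewrite /h adjM adjK.
  have wh : w h = (complex.Re (w h))%:C%C.
    by have := ger0_Im (w_ge0 x); rewrite -/h; case: (w h) => a b /= ->.
  rewrite wh lecR; apply/ler_addgt0Pr => e e0.
  (* The summand [e] brings the rescaled element strictly inside the unit ball, as the square root
     requires. *)
  set r := cnorm h + e; have r0 : 0 < r by rewrite ltr_wpDl // cnorm_ge0.
  have nr : normc (r^-1)%:C%C = r^-1.
    by rewrite /= expr0n addr0 sqrtr_sqr ger0_norm // invr_ge0 ltW.
  have := @positive_le_selfadjoint ((r^-1)%:C%C *: h).
  rewrite adjZ hh geC0_conj ?ler0c ?invr_ge0 ?(ltW r0) // => /(_ erefl).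
  rewrite cnormZ nr mulrC ltr_pdivrMr // mul1r ltrDl => /(_ e0).
  by rewrite scalarZ wh -rmorphM lecR mulrC ler_pdivrMr // mul1r.
have := le_trans cs wx; rewrite normr_normc -rmorphXn /= lecR.
by rewrite ler_sqr ?nnegrE ?cnorm_ge0 // -ler0c -normr_normc normr_ge0.
Qed.
End PositiveFunctional.

(** * States almost fixed by a combination of orthogonal isometries *)

Section IsometryFamily.
Variables (R : realType) (A : cstarAlgType R).
Local Notation C := (complex R).
Variables (I : finType) (S : I -> A) (c : I -> C).
Hypothesis S_orth : forall i j, adj (S i) * S j = (i == j)%:R.

Lemma adj_mul_comb (i : I) : adj (S i) * (\sum_j c j *: S j) = (c i)%:A.
Proof.
rewrite mulr_sumr (bigD1 i) //= -scalerAr S_orth eqxx big1 ?addr0 // => j ji.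
by rewrite -scalerAr S_orth eq_sym (negPf ji) scaler0.
Qed.

Variable w : {scalar A}.
Hypothesis w_ge0 : forall x : A, 0 <= w (adj x * x).
Hypothesis w1 : w 1 = 1.
Hypothesis wS : forall i, c i * w (S i) = `|c i| ^+ 2.

Let T := \sum_i c i *: S i.

(** By orthogonality and [wS], both [w (adj T * T)] and [w T] equal the sum [q] of the squared
    moduli, so the expansion is [q - q - q + 1]. *)
Lemma comb_fixed_defect : w (adj (T - 1) * (T - 1)) = 1 - \sum_i `|c i| ^+ 2.
Proof.
have TT : adj T * T = (\sum_i `|c i| ^+ 2)%:A.
  rewrite {1}/T adj_sum mulr_suml scaler_suml; apply: eq_bigr => i _.
  by rewrite adjZ -scalerAl adj_mul_comb scalerA normCKC.
have wT : w T = \sum_i `|c i| ^+ 2.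
  by rewrite linear_sum; apply: eq_bigr => i _ /=; rewrite scalarZ wS.
have r : (\sum_i `|c i| ^+ 2)^* = \sum_i `|c i| ^+ 2.
  by rewrite geC0_conj // sumr_ge0 // => i _; rewrite exprn_ge0.
rewrite adjB adj1 mulrBl mulrBr mul1r mulr1 TT !linearB /= positive_adj // wT r.
by rewrite scalarZ w1; ring.
Qed.

(** Cauchy-Schwarz with [t = (p + 1)^-1], where [p = w (x * adj x)]: this is defined even for
    [p = 0], and [2 * t - t ^+ 2 * p = t + t ^+ 2] is at least [t]. *)
Lemma comb_fixed_bound (x : A) : `|w (x * (T - 1))| ^+ 2 <=
  (w (x * adj x) + 1) * (1 - \sum_i `|c i| ^+ 2).
Proof.
have p0 : 0 <= w (x * adj x) by have := w_ge0 (adj x); rewrite adjK.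
set p := w (x * adj x) in p0 *.
have p1 : 0 < p + 1 by rewrite ltr_wpDl.
have t0 : 0 <= (p + 1)^-1 by rewrite invr_ge0 ltW.
have := positive_CauchySchwarz w_ge0 x (T - 1) t0.
rewrite comb_fixed_defect -/p mulrC; set q := 1 - _; set t := (p + 1)^-1 in t0 * => le.
rewrite -ler_pdivrMl // -/t; apply: le_trans le.
apply: ler_wpM2r; first by rewrite exprn_ge0.
have -> : 2 * t - t ^+ 2 * p = t + t ^+ 2.
  by rewrite /t; field; rewrite gt_eqF.
by rewrite lerDl exprn_ge0.
Qed.

(** Where right multiplication by [T] does not change [w], this evaluates [w (x * adj (S i))]. *)
Lemma comb_mul_adj (x : A) (i : I) : w (x * adj (S i) * T) = c i * w x.
Proof. by rewrite -mulrA adj_mul_comb -scalerAr mulr1 scalarZ. Qed.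
End IsometryFamily.

(** * Density of the words and their reduction to powers of [sn] *)

Section Words.
Variables (R : realType) (A : cstarAlgType R).
Local Notation C := (complex R).
Local Notation normc := ComplexField.Normc.normc.

Definition bounded_scalar (f : A -> C) :=
  exists2 M : R, 0 <= M & forall x, normc (f x) <= M * cnorm x.

(** Density of the span of the words, in dual form: the [x] for which precomposition with left
    multiplication by [x], and by [adj x], preserves vanishing on words form a closed
    star-subalgebra containing the generators, hence everything. The empty words then give
    [f x = 0]. *)
Lemma generates_eq0 n (s : 'I_n -> A) (f : {scalar A}) :
  cuntz_relations s -> generates s -> bounded_scalar f ->
  (forall J K, f ((\prod_(i <- J) s i) * adj (\prod_(i <- K) s i)) = 0) ->
  forall x, f x = 0.
Proof.
move=> [sO _] sgen fb f0.
pose W J := \prod_(i <- J) s i.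
pose killing (f : A -> C) := forall J K, f (W J * adj (W K)) = 0.
(* Quantifying over all bounded functionals killing the words makes [inv] closed
   under products without multiplying words together. *)
pose inv (x : A) := forall f : {scalar A}, bounded_scalar f -> killing f ->
  killing (fun y => f (x * y)).
have shift (x : A) (h : {scalar A}) : bounded_scalar h ->
    exists2 h' : {scalar A}, (forall y, h' y = h (x * y)) & bounded_scalar h'.
  move=> [M M0 hM].
  have [|h' hE] := @scalar_bundle R A (fun y => h (x * y)).
    by move=> a y z; rewrite mulrDr linearD /= -scalerAr scalarZ.
  exists h'; first by move=> y; rewrite -hE.
  exists (M * cnorm x) => [|y]; first by rewrite mulr_ge0 ?cnorm_ge0.
  by rewrite -hE (le_trans (hM _)) // -mulrA ler_wpM2l // ler_cnormM.
have inv1 : inv 1 by move=> h _ kh J K; rewrite mul1r.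
have invD (a : C) x y : inv x -> inv y -> inv (a *: x + y).
  move=> ix iy h bh kh J K.
  by rewrite mulrDl linearD -scalerAl /= scalarZ ix // iy // mulr0 addr0.
have invM x y : inv x -> inv y -> inv (x * y).
  move=> ix iy h bh kh J K; have [h' hE bh'] := shift x h bh.
  by rewrite -mulrA -hE; apply: iy => // {}J {}K; rewrite hE; exact: ix.
have inv_s i : inv (s i).
  by move=> h _ kh J K; have := kh (i :: J) K; rewrite /W big_cons mulrA.
(* In front of a nonempty [J], [adj (s i)] cancels the first letter or gives 0; for empty [J] it is
   absorbed into the adjoint part as a new last letter of [K]. *)
have inv_adj i : inv (adj (s i)).
  move=> h _ kh [|j J] K; rewrite /W.
    have := kh [::] (rcons K i).
    by rewrite /W big_nil big_rcons /= adjM !mul1r.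
  rewrite big_cons !mulrA sO; case: (i == j); last by rewrite !mul0r linear0.
  by rewrite mul1r; exact: kh.
have inv_closed x : (forall e : R, 0 < e -> exists2 y, inv y & cnorm (x - y) < e) ->
    inv x.
  move=> xc h [M M0 hM] kh J K; set v := W J * adj (W K).
  apply: ComplexField.Normc.eq0_normc; apply/eqP; rewrite eq_le.
  rewrite -[0 <= _]ler0c -normr_normc normr_ge0 andbT.
  apply/ler_addgt0Pr => e e0; rewrite add0r.
  set m := M * cnorm v + 1.
  have m0 : 0 < m by rewrite ltr_wpDl // mulr_ge0 ?cnorm_ge0.
  have [y iy xy] := xc (e / m) (divr_gt0 e0 m0).
  have -> : h (x * v) = h ((x - y) * v).
    by rewrite mulrBl linearB /= [h (y * v)]iy ?subr0 //; exists M.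
  rewrite (le_trans (hM _)) //.
  rewrite ltr_pdivlMr // in xy.
  have := ler_cnormM (x - y) v; have := cnorm_ge0 (x - y); have := cnorm_ge0 v.
  rewrite /m in xy * => *; nra.
(* Stability of [inv] under adjoints is not apparent, so it is built into [P]. *)
pose P x := inv x /\ inv (adj x).
have PT : P = [set: A]%classic.
  apply: sgen; rewrite /P.
  - move=> x xc; split; apply: inv_closed => e /xc[y [iy iay] xy].
      by exists y.
    by exists (adj y); rewrite // -adjB cnorm_adj.
  - by rewrite adj1.
  - by move=> i; split.
  - by move=> a x y [ix iax] [iy iay]; rewrite adjD adjZ; split; apply: invD.
  - by move=> x y [ix iax] [iy iay]; rewrite adjM; split; apply: invM.
  - by move=> x [ix iax]; rewrite adjK.
move=> x; have [ix _] : P x by rewrite PT.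
by have := ix f fb f0 [::] [::]; rewrite /W !big_nil adj1 !mulr1.
Qed.

Variables (d : nat) (s : 'I_d.+1 -> A).
Hypothesis s_cuntz : cuntz_relations s.
Local Notation sn := (s ord_max).
Local Notation e i := (s (widen_ord (leqnSn d) i)).

Lemma adj_powK r : adj (sn ^+ r) * sn ^+ r = 1.
Proof.
elim: r => [|r IHr]; first by rewrite expr0 adj1 mulr1.
rewrite {1}exprS exprS adjM -mulrA (mulrA (adj sn)) s_cuntz.1 eqxx mul1r //.
Qed.

Lemma adj_pow_mul r q (x : A) : (r <= q)%N ->
  adj (sn ^+ r) * (sn ^+ q * x) = sn ^+ (q - r) * x.
Proof. by move=> rq; rewrite -{1}(subnKC rq) exprD !mulrA adj_powK mul1r. Qed.

Lemma adj_e_sn i : adj (e i) * sn = 0.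
Proof.
rewrite s_cuntz.1 -val_eqE /= ltn_eqF //.
Qed.

Lemma adj_sn_e i : adj sn * e i = 0.
Proof. by rewrite -[LHS]adjK adjM adjK adj_e_sn adj0. Qed.

Lemma adj_pow_mul_e0 r q i : (q < r)%N -> adj (sn ^+ r) * (sn ^+ q * e i) = 0.
Proof.
move=> qr; rewrite -{1}(subnKC (ltnW qr)) exprD adjM -mulrA [X in _ * X]mulrA.
by rewrite adj_powK mul1r -(subnSK qr) exprS adjM -mulrA adj_sn_e mulr0.
Qed.

Lemma adj_pow_e_orth r q i j :
  adj (sn ^+ r * e i) * (sn ^+ q * e j) = ((r == q) && (i == j))%:R.
Proof.
rewrite adjM -mulrA; case: (ltngtP r q) => [rq|qr|<-].
- rewrite (adj_pow_mul _ (ltnW rq)) -(subnSK rq) exprS -mulrA mulrA adj_e_sn.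
  exact: mul0r.
- by rewrite (adj_pow_mul_e0 _ qr); exact: mulr0.
- by rewrite [X in _ * X]mulrA adj_powK mul1r s_cuntz.1.
Qed.

Lemma adj_pow_e_pow r k i : (r < k)%N -> adj (sn ^+ r * e i) * sn ^+ k = 0.
Proof.
move=> rk; rewrite -[sn ^+ k]mulr1 adjM -mulrA (adj_pow_mul _ (ltnW rk)).
by rewrite mulr1 -(subnSK rk) exprS mulrA adj_e_sn; exact: mul0r.
Qed.

(** A word is a product of blocks [sn ^+ q * e i] followed by a power of [sn]. Hypothesis [fe]
    strips the blocks from the adjoint factor, and [fadj] exchanges the two factors so that the
    other is treated likewise. *)
Lemma words_eq0 (f : {scalar A}) :
  (forall x, f (adj x) = (f x)^*) ->
  (forall r i x, f x = 0 -> f (x * adj (sn ^+ r * e i)) = 0) ->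
  (forall q r, f (sn ^+ q * adj (sn ^+ r)) = 0) ->
  forall J K, f ((\prod_(i <- J) s i) * adj (\prod_(i <- K) s i)) = 0.
Proof.
move=> fadj fe fn.
(* The exponent [q] counts the letters [sn] read since the last block ended. *)
have fK K : forall q x, (forall r, f (x * adj (sn ^+ r)) = 0) ->
    f (x * adj (sn ^+ q * \prod_(i <- K) s i)) = 0.
  elim: K => [|i K IHK] q x xr; first by rewrite big_nil mulr1.
  rewrite big_cons; case: (unliftP ord_max i) => [j ->|->]; last first.
    by rewrite mulrA -exprSr; exact: IHK.
  rewrite lift_max_widen.
  rewrite mulrA adjM mulrA; apply: fe.
  by have := IHK 0%N x xr; rewrite expr0 mul1r.
move=> J K; rewrite -[X in adj X]mul1r -(expr0 sn); apply: (fK K) => r.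
rewrite -[_ * _]adjK adjM adjK fadj.
by have := fK J 0%N (sn ^+ r) (fn r); rewrite expr0 mul1r => ->; rewrite conjC0.
Qed.
End Words.

(** * Uniqueness of geometric progression states *)

Section Uniqueness.
Variables (R : realType) (A : cstarAlgType R).
Local Notation C := (complex R).
Local Notation normc := ComplexField.Normc.normc.
Variables (d : nat) (s : 'I_d.+1 -> A).
Hypothesis s_cuntz : cuntz_relations s.
Hypothesis s_gen : generates s.
Local Notation sn := (s ord_max).
Local Notation e i := (s (widen_ord (leqnSn d) i)).

Lemma states_eq (w v : {scalar A}) : is_state w -> is_state v ->
  (forall r i x, w x = v x ->
    w (x * adj (sn ^+ r * e i)) = v (x * adj (sn ^+ r * e i))) ->
  (forall q r, w (sn ^+ q * adj (sn ^+ r)) = v (sn ^+ q * adj (sn ^+ r))) ->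
  w = v :> (A -> C).
Proof.
move=> [_ w0 wb w1] [_ v0 vb v1] we wn.
have [|f fE] := @scalar_bundle R A (fun x => w x - v x).
  by move=> a x y; rewrite !linearD /= !scalarZ; ring.
apply/funext => x; apply: subr0_eq; rewrite -[LHS]/((fun x => w x - v x) x) fE.
have fE' y : f y = w y - v y by rewrite -fE.
have fb : bounded_scalar f.
  exists 2 => // y; rewrite fE' -lecR -normr_normc (le_trans (ler_normB _ _)) //.
  by rewrite !normr_normc -rmorphD lecR; have := wb y; have := vb y => /= *; lra.
apply: (generates_eq0 s_cuntz s_gen fb); apply: words_eq0 => //.
- by move=> y; rewrite !fE' !positive_adj // rmorphB.
- move=> r i y; rewrite !fE' => /eqP; rewrite subr_eq0 => /eqP /we ->.
  by rewrite subrr.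
- by move=> q r; rewrite fE' wn subrr.
Qed.

(** * Uniqueness for finite order *)

Section FiniteOrder.
Variables (k : nat) (a : nat -> C) (b : C).
Hypothesis k_gt0 : (0 < k)%N.
Hypothesis ab1 :
  \sum_(r < k) \sum_(i < d) `|a (d * r + i)%N| ^+ 2 + `|b| ^+ 2 = 1.
Hypothesis b1 : `|b| < 1.

(** The coordinates before the last are read from a function on [nat], which keeps casts into
    ['I_(d * k).+1] out of the argument. *)
Definition finite_values (w : A -> C) :=
  (forall (r : 'I_k) (i : 'I_d), w (sn ^+ r * e i) = (a (d * r + i)%N)^*) /\
  w (sn ^+ k) = b^*.

Let I : finType := ('I_k * 'I_d + unit)%type.
Let S (x : I) : A :=
  match x with inl p => sn ^+ p.1 * e p.2 | inr _ => sn ^+ k end.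
Let c (x : I) : C := match x with inl p => a (d * p.1 + p.2)%N | inr _ => b end.

Let S_orth x y : adj (S x) * S y = (x == y)%:R.
Proof.
case: x y => [[r i]|[]] [[q j]|[]] /=; last by rewrite adj_powK.
- by rewrite adj_pow_e_orth.
- by rewrite adj_pow_e_pow.
- by rewrite adj_pow_mul_e0.
Qed.

Let sum_I (V : nmodType) (F : I -> V) :
  \sum_x F x = \sum_(r < k) \sum_(i < d) F (inl (r, i)) + F (inr tt).
Proof.
rewrite big_sumType /= pair_bigA /= (big_pred1 tt); last by case.
by congr (_ + _); apply: eq_bigr => [[]].
Qed.

Section OneState.
Variable w : {scalar A}.
Hypotheses (w_state : is_state w) (w_val : finite_values w).

Let w_fixed x : w x = w (x * \sum_i c i *: S i).
Proof.
have [_ w0 wb w1] := w_state; have [wr wk] := w_val.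
have wS i : c i * w (S i) = `|c i| ^+ 2.
  by case: i => [[r i]|[]]; rewrite normCK /= ?wr ?wk.
have := comb_fixed_bound S_orth w0 w1 wS x.
rewrite [X in 1 - X]sum_I /= ab1 subrr mulr0 -normrX normr_le0 expf_eq0 /=.
by rewrite mulrBr mulr1 linearB /= subr_eq0 => /eqP.
Qed.

Lemma finite_adj_e x (r : 'I_k) (i : 'I_d) :
  w (x * adj (sn ^+ r * e i)) = a (d * r + i)%N * w x.
Proof. by rewrite w_fixed (comb_mul_adj c S_orth w x (inl (r, i))). Qed.

Lemma finite_adj_pow x : w (x * adj (sn ^+ k)) = b * w x.
Proof. by rewrite w_fixed (comb_mul_adj c S_orth w x (inr tt)). Qed.

Lemma finite_expand x : w x =
  \sum_(r < k) \sum_(i < d) a (d * r + i)%N * w (x * (sn ^+ r * e i)) +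
  b * w (x * sn ^+ k).
Proof.
rewrite {1}w_fixed mulr_sumr linear_sum sum_I /= -scalerAr scalarZ.
congr (_ + _); apply: eq_bigr => r _; apply: eq_bigr => i _.
by rewrite -scalerAr scalarZ.
Qed.
End OneState.

Lemma finite_unique (w v : {scalar A}) : is_state w -> is_state v ->
  finite_values w -> finite_values v -> w = v :> (A -> C).
Proof.
move=> ws vs wv vv.
have [_ w0 _ w1] := ws; have [_ v0 _ v1] := vs.
(* Blocks with [r >= k] are shortened by splitting off [sn ^+ k], whose adjoint contributes the
   factor [b]. *)
have we r i x : w x = v x ->
    w (x * adj (sn ^+ r * e i)) = v (x * adj (sn ^+ r * e i)).
  move=> wvx; elim/ltn_ind: r => r IHr; have [rk|kr] := ltnP r k.
    by rewrite !(finite_adj_e _ _ _ (Ordinal rk)) // wvx.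
  rewrite -(subnKC kr) exprD -mulrA adjM mulrA !finite_adj_pow //.
  by rewrite IHr // -subn_gt0 subKn.
have wpe r i : w (sn ^+ r * e i) = v (sn ^+ r * e i).
  apply: (can_inj (@conjCK C)); rewrite -!positive_adj // -[adj _]mul1r.
  by apply: we; rewrite w1 v1.
have wp r : w (sn ^+ r) = v (sn ^+ r).
  (* Powers of [sn] commute, so [sn ^+ k] can be put first; after taking adjoints it stands last,
     where [finite_adj_pow] applies. *)
  have wpk (u : {scalar A}) : is_state u -> finite_values u ->
      u (sn ^+ r * sn ^+ k) = b^* * u (sn ^+ r).
    move=> us uv; have [_ u0 _ _] := us.
    rewrite -exprD addnC exprD -[_ * _]adjK positive_adj // adjM.
    by rewrite finite_adj_pow // positive_adj // rmorphM /= conjCK.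
  have bb : 1 - `|b| ^+ 2 != 0.
    by rewrite subr_eq0 eq_sym lt_eqF // exprn_ilt1.
  apply: (mulfI bb); have := finite_expand ws wv (sn ^+ r).
  have := finite_expand vs vv (sn ^+ r); rewrite !wpk // !mulrA -normCK.
  rewrite [X in _ = X + _](eq_bigr (fun q : 'I_k => \sum_(i < d)
    a (d * q + i)%N * w (sn ^+ r * (sn ^+ q * e i)))).
    by rewrite !mulrBl !mul1r => {1}-> {1}->; rewrite !addrK.
  by move=> q _; apply: eq_bigr => i _; rewrite !mulrA -exprD wpe.
(* For [r < k], multiplying by the fixing combination lets [adj (sn ^+ r)] cancel: each term becomes
   0, a block covered by [wpe], or a power covered by [wp]. For [r >= k], [adj (sn ^+ k)] is split
   off. *)
apply: states_eq => // q r; elim/ltn_ind: r => r IHr; have [rk|kr] := ltnP r k.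
  rewrite (finite_expand ws wv) (finite_expand vs vv).
  rewrite -!mulrA -[sn ^+ k]mulr1 !(adj_pow_mul s_cuntz _ (ltnW rk)) !mulr1 -!exprD wp.
  congr (_ + _); apply: eq_bigr => p _; apply: eq_bigr => i _.
  rewrite -!mulrA; have [pr|rp] := ltnP p r.
    by rewrite (adj_pow_mul_e0 s_cuntz _ pr) mulr0 !linear0.
  by rewrite (adj_pow_mul s_cuntz _ rp) mulrA -exprD wpe.
rewrite -(subnKC kr) exprD adjM mulrA !finite_adj_pow //.
by rewrite IHr // -subn_gt0 subKn.
Qed.
End FiniteOrder.

(** * Uniqueness for infinite order, by partial sums *)

Section InfiniteOrder.
Variable a : nat -> C.
Let norm_sum (K : nat) : R :=
  \sum_(r < K) \sum_(i < d) normc (a (d * r + i)%N) ^+ 2.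
Hypothesis a1 : (norm_sum K @[K --> \oo] --> (1 : R))%classic.

Definition infinite_values (w : A -> C) :=
  forall r (i : 'I_d), w (sn ^+ r * e i) = (a (d * r + i)%N)^*.

Let comb K : A :=
  \sum_(p : 'I_K * 'I_d) a (d * p.1 + p.2)%N *: (sn ^+ p.1 * e p.2).

Let S_orth K (x y : 'I_K * 'I_d) :
  adj (sn ^+ x.1 * e x.2) * (sn ^+ y.1 * e y.2) = (x == y)%:R.
Proof. by case: x y => [r i] [q j]; rewrite adj_pow_e_orth. Qed.

(** The deficit [1 - norm_sum K] tends to 0 by [a1]. Only the real part of [M] enters the limit, so
    values of [w] can serve as bounds directly. *)
Let eq0_of_bound (u M : C) K0 :
  (forall K, (K0 <= K)%N -> `|u| ^+ 2 <= M * (1 - (norm_sum K)%:C%C)) -> u = 0.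
Proof.
move=> uM; have u0 : normc u ^+ 2 <= 0.
  have lim0 : (complex.Re M * (1 - norm_sum K) @[K --> \oo] -->
      complex.Re M * (1 - 1))%classic.
    by apply: cvgMr; apply: cvgB => //; exact: cvg_cst.
  rewrite subrr mulr0 in lim0; rewrite -(cvg_lim _ lim0) //.
  apply: limr_ge; first by apply/cvg_ex; exists 0.
  near=> K; have /uM : (K0 <= K)%N by near: K; exact: nbhs_infty_ge.
  have -> : 1 - (norm_sum K)%:C%C = (1 - norm_sum K)%:C%C.
    by rewrite rmorphB rmorph1.
  rewrite normr_normc -rmorphXn lecE => /andP[_] /=.
  by case: (M) => p q /=; rewrite mulr0 subr0.
by apply: ComplexField.Normc.eq0_normc; apply/eqP; rewrite -sqrf_eq0 eq_le u0 sqr_ge0.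
Unshelve. all: by end_near.
Qed.

Let bound (w : {scalar A}) x K : is_state w -> infinite_values w ->
  `|w (x * (comb K - 1))| ^+ 2 <=
    (w (x * adj x) + 1) * (1 - (norm_sum K)%:C%C).
Proof.
move=> [_ w0 _ w1] wv.
have wS (p : 'I_K * 'I_d) : a (d * p.1 + p.2)%N * w (sn ^+ p.1 * e p.2) =
  `|a (d * p.1 + p.2)%N| ^+ 2 by rewrite wv normCK.
have := comb_fixed_bound (@S_orth K) w0 w1 wS x.
rewrite (_ : \sum_i `|_| ^+ 2 = (norm_sum K)%:C%C) // /norm_sum pair_bigA /=.
by rewrite rmorph_sum; apply: eq_bigr => p _; rewrite normr_normc -rmorphXn.
Qed.

Lemma infinite_adj_e (w : {scalar A}) x r (i : 'I_d) : is_state w ->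
  infinite_values w -> w (x * adj (sn ^+ r * e i)) = a (d * r + i)%N * w x.
Proof.
(* The threshold [r.+1] ensures that the block [(r, i)] occurs in [comb K]. *)
move=> ws wv; apply: subr0_eq; apply: (@eq0_of_bound _ _ r.+1) => K rK.
have := bound (x * adj (sn ^+ r * e i)) K ws wv.
have := comb_mul_adj (fun p : 'I_K * 'I_d => a (d * p.1 + p.2)%N) (@S_orth K)
  w x (Ordinal rK, i).
rewrite -/(comb K) /= => E.
by rewrite mulrBr mulr1 linearB /= E distrC; exact.
Qed.

Lemma infinite_unique (w v : {scalar A}) : is_state w -> is_state v ->
  infinite_values w -> infinite_values v -> w = v :> (A -> C).
Proof.
move=> ws vs wv vv.
have [_ w0 _ w1] := ws; have [_ v0 _ v1] := vs.
have we r i x : w x = v x ->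
    w (x * adj (sn ^+ r * e i)) = v (x * adj (sn ^+ r * e i)).
  by move=> wvx; rewrite !infinite_adj_e // wvx.
apply: states_eq => // q r; apply: subr0_eq; set x := _ * _.
(* The constant comes from [|p' - p| ^+ 2 <= 2 * |p| ^+ 2 + 2 * |p'| ^+ 2], with [bound] applied to
   each state. *)
apply: (@eq0_of_bound _ (2 * (w (x * adj x) + 1) + 2 * (v (x * adj x) + 1)) 0) => K _.
(* Each term of [x * comb K] is 0 or a multiple of some [sn ^+ m * e i], on which the values of both
   states are prescribed. *)
have wvT : w (x * comb K) = v (x * comb K).
  rewrite /comb mulr_sumr !linear_sum; apply: eq_bigr => -[p i] _ /=.
  rewrite -scalerAr !scalarZ /x -mulrA; congr (_ * _).
  have [pr|rp] := ltnP p r.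
    by rewrite (adj_pow_mul_e0 s_cuntz _ pr) mulr0 !linear0.
  by rewrite (adj_pow_mul s_cuntz _ rp) mulrA -exprD wv vv.
have -> : w x - v x = v (x * (comb K - 1)) - w (x * (comb K - 1)).
  by rewrite !mulrBr !mulr1 !linearB /= wvT; ring.
have := bound x K ws wv; have := bound x K vs vv.
set p := w (_ * (_ - _)); set p' := v (_ * (_ - _)) => bv bw.
have le2 : `|p' - p| ^+ 2 <= 2 * `|p| ^+ 2 + 2 * `|p'| ^+ 2.
  (* By the parallelogram identity the difference of the two sides is [|p + p'| ^+ 2]. *)
  rewrite -subr_ge0; apply: le_trans (_ : 0 <= `|p + p'| ^+ 2) _.
    by rewrite exprn_ge0.
  by rewrite !normCK !rmorphD rmorphN /= le_eqVlt; apply/orP; left; apply/eqP; ring.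
apply: (le_trans le2); rewrite [leRHS]mulrDl.
by apply: lerD; rewrite -mulrA ler_pM2l // ltr0n.
Qed.
End InfiniteOrder.
End Uniqueness.

(** * The action of the unitary group on generators and states *)

Section Action.
Variables (R : realType) (A : cstarAlgType R).
Local Notation C := (complex R).
Local Notation normc := ComplexField.Normc.normc.

(** Since [star_hom] has no norm clause, contractivity is recovered from positivity and the value at
    1. *)
Lemma is_state_comp (w : A -> C) (f : A -> A) :
  star_hom f -> is_state w -> is_state (w \o f).
Proof.
move=> [fL fM f1 fadj] [wL w0 _ w1].
have [|u uE] := @scalar_bundle R A (w \o f).
  by move=> c x y; rewrite /= fL wL.
have u0 x : 0 <= u (adj x * x) by rewrite -uE /= fM fadj.
have u1 : u 1 = 1 by rewrite -uE /= f1.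
split=> //; first by rewrite uE; exact: linearP.
- by move=> x; rewrite uE.
- by move=> x; rewrite uE; exact: positive_contractive.
- by rewrite uE.
Qed.

Lemma mulmx_embed_last n (g h : 'M[C]_n) :
  embed_last g *m embed_last h = embed_last (g *m h).
Proof.
apply/matrixP => i j; rewrite !mxE big_ord_recr /=.
under eq_bigr do rewrite !mxE -lift_max_widen liftK.
rewrite !mxE unlift_none.
case: (unliftP ord_max i) => [i' _|_]; case: (unliftP ord_max j) => [j' _|_].
- by rewrite mul0r addr0 mxE.
- by rewrite big1 ?mulr1 ?addr0 // => x _; rewrite mulr0.
- by rewrite big1 ?mulr0 ?addr0 // => x _; rewrite mul0r.
- by rewrite big1 ?mul1r ?add0r // => x _; rewrite mul0r.
Qed.

Lemma embed_last1 n : embed_last (1%:M : 'M[C]_n) = 1%:M.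
Proof.
apply/matrixP => i j; rewrite !mxE.
case: (unliftP ord_max i) => [i' ->|->]; case: (unliftP ord_max j) => [j' ->|->].
- by rewrite !mxE (inj_eq lift_inj).
- by rewrite eq_sym (negPf (neq_lift _ _)).
- by rewrite (negPf (neq_lift _ _)).
- by rewrite eqxx.
Qed.

Lemma embed_last_trC n (g : 'M[C]_n) :
  (embed_last g)^t*%sesqui = embed_last (g^t*%sesqui).
Proof.
apply/matrixP => i j; rewrite !mxE.
case: (unlift ord_max i) => [i'|]; case: (unlift ord_max j) => [j'|];
  by rewrite ?mxE ?conjC0 ?conjC1.
Qed.

Lemma embed_last_unitary n (g : 'M[C]_n) :
  g \is unitarymx -> embed_last g \is unitarymx.
Proof.
move=> /unitarymxP gU; apply/unitarymxP.
by rewrite embed_last_trC mulmx_embed_last gU embed_last1.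
Qed.

(** If [P'] selects [w'], then [w' \o f'] satisfies [P], so uniqueness identifies it with the
    element chosen from [P], and composing with [f] returns [w']. If [P] is empty then so is [P'],
    and both sides are the zero default. *)
Lemma xget_comp (P P' : set (A -> C)) (f f' : A -> A) :
  (forall w, P w -> P' (w \o f)) -> (forall w, P' w -> P (w \o f')) ->
  (forall x, f' (f x) = x) -> (forall w v, P w -> P v -> w = v) ->
  xget (fun=> 0) P \o f = xget (fun=> 0) P'.
Proof.
move=> PP' P'P f'f Puniq; case: (xgetP (fun=> 0) P) => [w _ Pw|P0].
  case: xgetP => [w' _ P'w'|/(_ _ (PP' _ Pw))//].
  rewrite (Puniq _ _ Pw (P'P _ P'w')).
  by apply/funext => x /=; rewrite f'f.
by case: xgetP => [w' _ /P'P /P0|_].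
Qed.

Variables (d : nat) (s : 'I_d.+1 -> A).
Hypothesis s_cuntz : is_cuntz_algebra s.
Local Notation sn := (s ord_max).
Local Notation e i := (s (widen_ord (leqnSn d) i)).
Local Notation alpha g := (cuntz_act s (embed_last g)).

Lemma cuntz_act_last (g : 'M[C]_d) : g \is unitarymx -> alpha g sn = sn.
Proof.
move=> /embed_last_unitary gU; rewrite (cuntz_actP s_cuntz gU).2.
rewrite big_ord_recr /= !mxE unlift_none scale1r big1 ?add0r // => j _.
rewrite !mxE unlift_none; case: unliftP => [j' _|/eqP]; first by rewrite scale0r.
by rewrite -val_eqE /= ltn_eqF.
Qed.

Lemma cuntz_act_e (g : 'M[C]_d) (i : 'I_d) : g \is unitarymx ->
  alpha g (e i) = \sum_j g j i *: e j.
Proof.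
move=> /embed_last_unitary gU; rewrite (cuntz_actP s_cuntz gU).2.
rewrite big_ord_recr /= !mxE unlift_none -lift_max_widen liftK scale0r addr0.
by apply: eq_bigr => j _; rewrite !mxE -lift_max_widen !liftK.
Qed.

Lemma star_homX (f : A -> A) x n : star_hom f -> f (x ^+ n) = f x ^+ n.
Proof.
by move=> [_ fM f1 _]; elim: n => [|n IHn]; rewrite ?expr0 // !exprS fM IHn.
Qed.

(** The composite fixes every generator by unitarity, so the uniqueness clause of the universal
    property makes it the identity. *)
Lemma cuntz_act_trCK (g : 'M[C]_d) x : g \is unitarymx ->
  alpha g (alpha (g^t*%sesqui) x) = x.
Proof.
move=> gU; have hU : g^t*%sesqui \is unitarymx by rewrite trmxC_unitary.
have [[gL gM g1 ga] gs] := cuntz_actP s_cuntz (embed_last_unitary gU).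
have [[hL hM h1 ha] hs] := cuntz_actP s_cuntz (embed_last_unitary hU).
have [srel _ univ] := s_cuntz; have [f [_ funiq]] := univ A s srel.
have E1 : f = idfun by apply: funiq; split.
suff E2 : f = alpha g \o alpha (g^t*%sesqui).
  by rewrite -[LHS]/((alpha g \o alpha (g^t*%sesqui)) x) -E2 E1.
apply: funiq; split.
  split=> [c y z|y z||y] /=; first by rewrite hL gL.
  - by rewrite hM gM.
  - by rewrite h1 g1.
  - by rewrite ha ga.
have gsum (a : 'I_d -> C) (F : 'I_d -> A) :
    alpha g (\sum_j a j *: F j) = \sum_j a j *: alpha g (F j).
  pose ag := HB.pack_for {linear A -> A} (alpha g)
    (GRing.isLinear.Build _ _ _ _ (alpha g) gL).
  by rewrite -[alpha g]/(ag : A -> A) linear_sum; under eq_bigr do rewrite linearZ.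
move=> i; case: (unliftP ord_max i) => [j ->|->] /=; last by rewrite !cuntz_act_last.
rewrite lift_max_widen.
rewrite cuntz_act_e // gsum.
under eq_bigr do rewrite cuntz_act_e // scaler_sumr.
rewrite exchange_big (bigD1 j) //= [X in _ + X]big1 => [|l lj].
  rewrite addr0; under eq_bigr do rewrite scalerA mulrC.
  rewrite -scaler_suml; have /unitarymxP := gU.
  move=> /matrixP /(_ j j); rewrite !mxE eqxx => ->; exact: scale1r.
under eq_bigr do rewrite scalerA mulrC.
rewrite -scaler_suml; have /unitarymxP := gU.
move=> /matrixP /(_ l j); rewrite !mxE (negPf lj) => ->; exact: scale0r.
Qed.

Lemma is_state_act (g : 'M[C]_d) (w : A -> C) :
  g \is unitarymx -> is_state w -> is_state (w \o alpha g).
Proof.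
by move=> /embed_last_unitary gU; apply: is_state_comp; have [] := cuntz_actP s_cuntz gU.
Qed.

(** The conjugates are the entries of [g^t*%sesqui]; since states prescribe conjugated coordinates,
    the sum is the conjugate of a coordinate transformed by [g] itself. *)
Lemma state_act_e (g : 'M[C]_d) (w : A -> C) r (i : 'I_d) : scalar w ->
  g \is unitarymx ->
  w (alpha (g^t*%sesqui) (sn ^+ r * e i)) = \sum_j (g i j)^* * w (sn ^+ r * e j).
Proof.
move=> wL gU; have hU : g^t*%sesqui \is unitarymx by rewrite trmxC_unitary.
have [hh _] := cuntz_actP s_cuntz (embed_last_unitary hU).
have [w' ->] := scalar_bundle wL.
have [_ hM _ _] := hh; rewrite hM star_homX // cuntz_act_last // cuntz_act_e //.
rewrite mulr_sumr linear_sum; apply: eq_bigr => j _ /=.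
by rewrite -scalerAr scalarZ !mxE.
Qed.

Lemma state_act_pow (g : 'M[C]_d) (w : A -> C) r : g \is unitarymx ->
  w (alpha (g^t*%sesqui) (sn ^+ r)) = w (sn ^+ r).
Proof.
move=> gU; have hU : g^t*%sesqui \is unitarymx by rewrite trmxC_unitary.
have [hh _] := cuntz_actP s_cuntz (embed_last_unitary hU).
by rewrite star_homX // cuntz_act_last.
Qed.

Lemma infinite_values_act (g : 'M[C]_d) (a a' : nat -> C) (w : A -> C) : scalar w ->
  g \is unitarymx ->
  (forall r (i : 'I_d), a' (d * r + i)%N = \sum_j g i j * a (d * r + j)%N) ->
  infinite_values s a w -> infinite_values s a' (w \o alpha (g^t*%sesqui)).
Proof.
move=> wL gU a'E wv r i; rewrite /= state_act_e // a'E rmorph_sum.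
by apply: eq_bigr => j _; rewrite wv rmorphM.
Qed.

Lemma finite_values_act (g : 'M[C]_d) k (a a' : nat -> C) b (w : A -> C) : scalar w ->
  g \is unitarymx ->
  (forall (r : 'I_k) (i : 'I_d), a' (d * r + i)%N = \sum_j g i j * a (d * r + j)%N) ->
  finite_values s k a b w -> finite_values s k a' b (w \o alpha (g^t*%sesqui)).
Proof.
move=> wL gU a'E [wv wk]; split; last by rewrite /= state_act_pow.
move=> r i; rewrite /= state_act_e // a'E rmorph_sum.
by apply: eq_bigr => j _; rewrite wv rmorphM.
Qed.
End Action.

(** * The block-diagonal operator in coordinates *)

Section Tilde.
Variable R : realType.
Local Notation C := (complex R).
Local Notation normc := ComplexField.Normc.normc.

Lemma sum_blocks (V : nmodType) (d K : nat) (F : nat -> V) :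
  \sum_(y < d * K) F y = \sum_(b < K) \sum_(j < d) F (d * b + j)%N.
Proof.
elim: K => [|K IHK]; first by rewrite muln0 !big_ord0.
by rewrite mulnS addnC big_split_ord big_ord_recr /= IHK.
Qed.

Lemma sum_tilde_coef (d K : nat) (g : 'M[C]_d) (F : nat -> C) r (i : 'I_d) :
  (r < K)%N -> \sum_(y < d * K) tilde_coef g (d * r + i) y * F y =
    \sum_j g i j * F (d * r + j)%N.
Proof.
move=> rK; rewrite (sum_blocks _ _ (fun y => tilde_coef g (d * r + i) y * F y)).
rewrite (bigD1 (Ordinal rK)) //= [X in _ + X]big1 ?addr0 => [|b br].
  by apply: eq_bigr => j _; rewrite tilde_coefE eqxx mul1r.
rewrite big1 // => j _; rewrite tilde_coefE eq_sym.
by move: br; rewrite -val_eqE /= => /negPf ->; rewrite !mul0r.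
Qed.

Lemma tilde_mx_inord (d k : nat) (g : 'M[C]_d) (z : 'cV[C]_(d * k).+1)
    (r : 'I_k) (i : 'I_d) :
  (tilde_mx k g *m z) (inord (d * r + i)) 0 =
    \sum_j g i j * z (inord (d * r + j)) 0.
Proof.
have lt : (d * r + i < d * k)%N.
  rewrite (@leq_trans (d * r.+1)) // ?leq_mul2l ?ltn_ord ?orbT //.
  by rewrite mulnS addnC ltn_add2r.
have -> : inord (d * r + i) = lift ord_max (Ordinal lt) :> 'I_(d * k).+1.
  by rewrite lift_max_widen; apply: val_inj; rewrite /= inordK // ltnS ltnW.
rewrite mxE big_ord_recr /= mxE liftK unlift_none mul0r addr0.
rewrite -(sum_tilde_coef g (fun y => z (inord y) 0) i (ltn_ord r)).
apply: eq_bigr => y _; rewrite mxE liftK -lift_max_widen liftK mxE lift_max_widen /=.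
by congr (_ * z _ 0); apply: val_inj; rewrite /= inordK // ltnS ltnW.
Qed.

Lemma tilde_mx_max (d k : nat) (g : 'M[C]_d) (z : 'cV[C]_(d * k).+1) :
  (tilde_mx k g *m z) ord_max 0 = z ord_max 0.
Proof.
rewrite mxE big_ord_recr /= mxE unlift_none mul1r big1 ?add0r // => x _.
rewrite mxE unlift_none; case: unliftP => [j' _|/eqP]; first by rewrite mul0r.
by rewrite -val_eqE /= ltn_eqF.
Qed.

Lemma tilde_coef_eq0 (d : nat) (g : 'M[C]_d) r (i : 'I_d) y :
  (d * r.+1 <= y)%N -> tilde_coef g (d * r + i) y = 0.
Proof.
move=> ry; have d0 : (0 < d)%N by apply: leq_ltn_trans (ltn_ord i).
rewrite (divn_eq y d) [(_ %/ _ * d)%N]mulnC.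
rewrite -[(y %% d)%N]/(nat_of_ord (Ordinal (ltn_pmod y d0))).
by rewrite tilde_coefE ltn_eqF ?mul0r // leq_divRL // mulnC.
Qed.

(** The row of index [d * r + i] vanishes beyond its block, so the partial sums are constant from
    [d * r.+1] on. *)
Lemma ell2_mul_tilde (d : nat) (g : 'M[C]_d) (z : nat -> C) r (i : 'I_d) :
  ell2_mul (tilde_coef g) z (d * r + i)%N = \sum_j g i j * z (d * r + j)%N.
Proof.
rewrite /ell2_mul; apply: (@lim_near_cst C^o); first exact: norm_hausdorff.
near=> N; have rN : (d * r.+1 <= N)%N by near: N; exact: nbhs_infty_ge.
pose F y := tilde_coef g (d * r + i) y * z y.
rewrite -(sum_tilde_coef g z i (leqnn r.+1)) seriesEord /=.
rewrite (big_ord_widen_cond N xpredT F rN).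
rewrite [LHS](bigID (fun y : 'I_N => y < d * r.+1)%N) /=.
rewrite [X in _ + X]big1 ?addr0 // => y; rewrite -leqNgt => ry.
by rewrite tilde_coef_eq0 // mul0r.
Unshelve. all: by end_near.
Qed.

(** Recovers the coordinates of [z] from those of its transform, for the converse direction demanded
    by [xget_comp]. *)
Lemma block_trCK (d : nat) (g : 'M[C]_d) (a a' : nat -> C) r :
  g \is unitarymx ->
  (forall i : 'I_d, a' (d * r + i)%N = \sum_j g i j * a (d * r + j)%N) ->
  forall i : 'I_d, a (d * r + i)%N = \sum_j g^t*%sesqui i j * a' (d * r + j)%N.
Proof.
move=> gU a'E i; under eq_bigr do rewrite a'E mulr_sumr.
rewrite exchange_big /=.
have /matrixP gg : g^t*%sesqui *m g = 1%:M by apply: mulmx1C; apply/unitarymxP.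
rewrite (bigD1 i) //= [X in _ + X]big1 ?addr0 => [|l li].
  under eq_bigr do rewrite mulrA.
  by rewrite -mulr_suml; have := gg i i; rewrite mxE => ->; rewrite mxE eqxx mul1r.
under eq_bigr do rewrite mulrA.
rewrite -mulr_suml; have := gg i l; rewrite mxE => ->.
by rewrite mxE eq_sym (negPf li) mul0r.
Qed.

End Tilde.

(* d stands for n - 1 *)
Theorem theorem1p12 (R : realType) (d : nat) (d_gt0 : (0 < d)%N)
    (A : cstarAlgType R) (s : 'I_d.+1 -> A) (sA : is_cuntz_algebra s) :
  (forall (k : nat) (k_ge2 : (2 <= k)%N) (z : 'cV[complex R]_(d * k).+1),
     in_W z ->
     forall g : 'M[complex R]_d, g \is unitarymx ->
       cuntz_act_dual s (embed_last g) (gp_state s z)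
       = gp_state s (tilde_mx k g *m z))
  /\
  (forall z : nat -> complex R, ell2_unit z ->
     forall g : 'M[complex R]_d, g \is unitarymx ->
       cuntz_act_dual s (embed_last g) (gp_state_infty s z)
       = gp_state_infty s (ell2_mul (tilde_coef g) z)).
Proof.
have [srel sgen _] := sA.
have hU (g : 'M[complex R]_d) : g \is unitarymx -> g^t*%sesqui \is unitarymx.
  by rewrite trmxC_unitary.
have trCK (g : 'M[complex R]_d) : (g^t*%sesqui)^t*%sesqui = g.
  by apply/matrixP => i j; rewrite !mxE conjCK.
split=> [k k_ge2 z [z1 zm1]|z z1] g gU;
    rewrite /cuntz_act_dual (invmx_unitary (embed_last_unitary gU)) embed_last_trC.
- pose a y := z (inord y) 0; pose a' y := (tilde_mx k g *m z) (inord y) 0.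
  have a'E (r : 'I_k) (i : 'I_d) : a' (d * r + i)%N = \sum_j g i j * a (d * r + j)%N.
    exact: tilde_mx_inord.
  have aE (r : 'I_k) := block_trCK gU (a'E r).
  apply: (@xget_comp _ _ _ _ _ (cuntz_act s (embed_last g))).
  + move=> w [ws wr wk]; have [wL _ _ _] := ws.
    have [] := finite_values_act sA wL gU a'E (conj wr wk).
    by split; rewrite ?tilde_mx_max //; exact: (is_state_act sA (hU _ gU) ws).
  + move=> w [ws wr wk]; have [wL _ _ _] := ws; rewrite tilde_mx_max in wk.
    have := finite_values_act sA wL (hU _ gU) aE (conj wr wk); rewrite trCK => -[].
    by split => //; exact: (is_state_act sA gU ws).
  + by move=> x; rewrite cuntz_act_trCK.
  + move=> w v [ws wr wk] [vs vr vk].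
    have [wL _ _ _] := ws; have [vL _ _ _] := vs.
    have [w' wE] := scalar_bundle wL; have [v' vE] := scalar_bundle vL; subst w v.
    apply: (finite_unique srel sgen (k := k) (a := a) (b := z ord_max 0)) => //.
    * by rewrite (leq_trans _ k_ge2).
    (* The unit norm of [z], with the last coordinate set apart and the others grouped into [k]
       blocks of length [d]. *)
    * rewrite -(sum_blocks _ _ (fun y => `|a y| ^+ 2)).
      rewrite -[RHS](rmorph1 (real_complex R)) -z1 rmorph_sum big_ord_recr /=.
      rewrite normr_normc -rmorphXn; congr (_ + _); apply: eq_bigr => y _.
      rewrite normr_normc -rmorphXn /a.
      congr ((ComplexField.Normc.normc (z _ 0) ^+ 2)%:C%C).
      by apply: val_inj; rewrite /= inordK // ltnS ltnW.
    * by rewrite normr_normc -[1]/(1%:C%C) ltcR.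
- have aE r := block_trCK gU (ell2_mul_tilde g z r).
  apply: (@xget_comp _ _ _ _ _ (cuntz_act s (embed_last g))).
  + move=> w [ws wr]; have [wL _ _ _] := ws.
    by split; [exact: (is_state_act sA (hU _ gU) ws)|
      exact: (infinite_values_act sA wL gU (ell2_mul_tilde g z))].
  + move=> w [ws wr]; have [wL _ _ _] := ws.
    have := infinite_values_act sA wL (hU _ gU) aE wr; rewrite trCK.
    by split => //; exact: (is_state_act sA gU ws).
  + by move=> x; rewrite cuntz_act_trCK.
  + move=> w v [ws wr] [vs vr].
    have [wL _ _ _] := ws; have [vL _ _ _] := vs.
    have [w' wE] := scalar_bundle wL; have [v' vE] := scalar_bundle vL; subst w v.
    apply: (infinite_unique srel sgen (a := z)) => //.
    (* The uniqueness lemma sums over whole blocks, that is, along the partial sums of length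
       [d * K], and these lengths tend to infinity because [0 < d]. *)
    have dcvg : (d * K @[K --> \oo] --> \oo)%classic.
      have -> : (fun K => d * K)%N = (fun K => K * d)%N.
        by apply/funext => K; rewrite mulnC.
      exact: cvg_mulnr.
    have := cvg_comp _ _ dcvg z1; apply: cvg_trans; apply: near_eq_cvg.
    apply: nearW => K /=.
    by rewrite seriesEord /=
      -(sum_blocks _ _ (fun y => ComplexField.Normc.normc (z y) ^+ 2)).
Qed.
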